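(* Let $f:A\to B$ be a ring homomorphism and let $J$ be an ideal of $B$. Assume that $A$ is a local ring with maximal ideal $M$ and that $J\subseteq\mathrm{Jac}(B)$. Then: (1) If $A\bowtie^f J$ has finitely generated maximal ideal, then $A$ also has finitely generated maximal ideal, and $\mathrm{embdim}(A)\le\mathrm{embdim}(A\bowtie^f J)$. (2) Suppose $B=f(A)+J$. If $A$ has finitely generated maximal ideal and $J$ is finitely generated, then $A\bowtie^f J$ has finitely generated maximal ideal, and $\mathrm{embdim}(A\bowtie^f J)\le \mathrm{embdim}(A)+\nu(J)$.
   Context: All rings are commutative with unity; ''local'' means having exactly one maximal ideal. $A\bowtie^f J:=\{(a,f(a)+j)\mid a\in A,\ j\in J\}$ is a subring of $A\times B$; under the hypotheses it is a local ring with maximal ideal $\{(m,f(m)+j)\mid m\in M,\ j\in J\}$. $\mathrm{Jac}(B)$ is the Jacobson radical of $B$. For a finitely generated ideal $I$ of a ring, $\nu(I)$ is the minimum number of generators of $I$. For a local ring $R$ with finitely generated maximal ideal $N$, $\mathrm{embdim}(R):=\nu(N)=\dim_{R/N}(N/N^2)$. *)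

(* Defs.v *)
From HB Require Import structures.
From mathcomp Require Import all_boot all_order all_algebra.
From mathcomp Require Import boolp classical_sets.

Set Implicit Arguments.
Unset Strict Implicit.
Unset Printing Implicit Defensive.

Import GRing.Theory.
Local Open Scope classical_set_scope.
Local Open Scope ring_scope.

(* Rings are [comPzRingType]: the zero ring is allowed (for B).  The ideals of
   [ring_quotient] are boolean predicates on nonzero rings and are proper by
   definition, whereas J and the ideals to which [nu] applies are arbitrary. *)

Section Ideals.
Variable R : comPzRingType.
Implicit Types (I N : set R) (n m : nat).

Definition is_ideal I : Prop :=
  [/\ I 0, forall x y, I x -> I y -> I (x + y) & forall a x, I x -> I (a * x)].

Definition maximal_ideal N : Prop :=
  [/\ is_ideal N, ~ N 1 & forall I, is_ideal I -> ~ I 1 -> N `<=` I -> I = N].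

Definition jacobson : set R := [set x | forall N, maximal_ideal N -> N x].

Definition span n (g : 'I_n -> R) : set R :=
  [set \sum_(i < n) c i * g i | c in [set: 'I_n -> R]].

Definition generated_by n I : Prop := exists g : 'I_n -> R, I = span g.

Definition fin_gen I : Prop := exists n, generated_by n I.

(* The least n such that n elements generate I; 0 if I is not finitely
   generated. *)
Definition nu I : nat :=
  xget 0%N [set n | generated_by n I /\
                    forall m, generated_by m I -> (n <= m)%N].

End Ideals.

Arguments jacobson : clear implicits.

Definition local (R : comPzRingType) : Prop := exists! N : set R, maximal_ideal N.

Definition local_max (R : comPzRingType) (locR : local R) : set R :=
  projT1 (cid locR).

Definition embdim (R : comPzRingType) (locR : local R) : nat :=
  nu (local_max locR).

Record ideal (R : comPzRingType) := Ideal {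
  ideal_set :> set R;
  idealP : is_ideal ideal_set
}.

Section IdealTheory.
Variable R : comPzRingType.
Implicit Types I N : set R.

Lemma is_idealN I x : is_ideal I -> I x -> I (- x).
Proof. by case=> _ _ IM Ix; rewrite -mulN1r; exact: IM. Qed.

Lemma is_idealB I x y : is_ideal I -> I x -> I y -> I (x - y).
Proof. by move=> idI Ix Iy; case: (idI) => _ ID _; apply: ID => //; exact: is_idealN. Qed.

Lemma krull I : is_ideal I -> ~ I 1 -> exists2 N, maximal_ideal N & I `<=` N.
Proof.
move=> idI I1.
pose P : set (set R) := [set X | X = set0 \/ [/\ is_ideal X, ~ X 1 & I `<=` X]].
have [|N [PN maxN]] := @Zorn_bigcup _ P.
  move=> F FP totF.
  have [[X0 [FX0 [x0 X0x0]]]|noF] := pselect (exists X, F X /\ X !=set0); last first.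
    left; rewrite -subset0 => x [X FX Xx]; case: noF; exists X; split => //.
    by exists x.
  have big X x : F X -> X x -> [/\ is_ideal X, ~ X 1 & I `<=` X].
    by move=> /FP[->|].
  have [id0 _ I0] := big _ _ FX0 X0x0.
  right; split.
  - split.
    + by exists X0 => //; case: id0.
    + move=> x y [X FX Xx] [Y FY Yy].
      have [[_ DX _] _ _] := big _ _ FX Xx.
      have [[_ DY _] _ _] := big _ _ FY Yy.
      have [XY|YX] := totF _ _ FX FY.
        by exists Y => //; apply: DY => //; exact: XY.
      by exists X => //; apply: DX => //; exact: YX.
    + move=> a x [X FX Xx]; exists X => //.
      by have [[_ _ MX] _ _] := big _ _ FX Xx; exact: MX.
  - by move=> [X FX X1]; have [_ + _] := big _ _ FX X1; apply.
  - by move=> x Ix; exists X0 => //; exact: I0.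
case: PN => [N0|[idN N1 IN]].
  exfalso; apply: (maxN I); last by right; split.
  rewrite N0; rewrite properEneq; split; last exact: sub0set.
  by apply/eqP => I0; case: idI; rewrite -I0.
exists N => //; split=> // K idK K1 NK.
apply: contrapT => KN; apply: (maxN K).
  by rewrite properEneq; split=> //; apply/eqP => NK'; apply: KN.
by right; split=> //; exact: subset_trans NK.
Qed.

Lemma nonunit_in_maximal (a : R) :
  (forall N, maximal_ideal N -> ~ N a) -> exists b, a * b = 1.
Proof.
move=> Na; apply: contrapT => nou.
have [||N mN aN] := @krull [set a * b | b in setT].
- split; first by exists 0; rewrite ?mulr0.
  + by move=> _ _ [b _ <-] [c _ <-]; exists (b + c); rewrite ?mulrDr.
  + by move=> c _ [b _ <-]; exists (c * b) => //; rewrite mulrCA.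
- by move=> [b _ ab]; apply: nou; exists b.
by apply: (Na N mN); apply: aN; exists 1; rewrite ?mulr1.
Qed.

Lemma jacobson_unit (u v j : R) :
  u * v = 1 -> jacobson R j -> exists b, (u + j) * b = 1.
Proof.
move=> uv Jj; apply: nonunit_in_maximal => N mN Nuj.
have [idN N1 _] := mN; apply: N1; rewrite -uv mulrC.
case: (idN) => _ _; apply; rewrite -(addrK j u).
by apply: is_idealB => //; exact: Jj.
Qed.

Lemma nonunits_maximal N : is_ideal N -> ~ N 1 ->
    (forall x, ~ N x -> exists y, x * y = 1) ->
  forall I, maximal_ideal I <-> I = N.
Proof.
move=> idN N1 unitN.
have sub I : is_ideal I -> ~ I 1 -> I `<=` N.
  move=> [_ _ IM] I1 x Ix; apply: contrapT => /unitN[y xy].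
  by apply: I1; rewrite -xy mulrC; exact: IM.
move=> I; split=> [[idI I1 maxI]|->].
  by rewrite (maxI N) //; exact: sub.
split=> // K idK K1 NK; apply/seteqP; split=> //; exact: sub.
Qed.

Lemma local_maxP (locR : local R) : maximal_ideal (local_max locR).
Proof. by rewrite /local_max; case: cid => N []. Qed.

Lemma local_maxE (locR : local R) N : maximal_ideal N -> local_max locR = N.
Proof.
move=> mN; have [N0 [_ uN0]] := locR.
by rewrite -(uN0 _ mN) -(uN0 _ (local_maxP locR)).
Qed.

End IdealTheory.

Section Amalgamation.
Variables (A B : comPzRingType) (f : {rmorphism A -> B}) (J : ideal B).

Definition amalg_set : set (A * B) :=
  [set (a, f a + j) | a in [set: A] & j in (J : set B)].

Definition amalg_pred : {pred A * B} := [pred x | x \in amalg_set].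

Lemma amalg_predE x : (x \in amalg_pred) = `[< ideal_set J (x.2 - f x.1) >].
Proof.
rewrite inE; apply: asbool_equiv_eq; split=> [[a _ [j Jj <-]] /=|Jx].
  by rewrite addrC addKr.
exists x.1 => //; exists (x.2 - f x.1) => //.
by rewrite addrC subrK; case: x Jx.
Qed.

Lemma amalg_subring_closed : subring_closed amalg_pred.
Proof.
have [J0 JD JM] := idealP J; split.
- by rewrite amalg_predE /= rmorph1 subrr; apply/asboolP.
- move=> x y; rewrite !amalg_predE => /asboolP Jx /asboolP Jy.
  apply/asboolP; rewrite /= rmorphB.
  rewrite opprD addrACA -opprD; exact: (is_idealB (idealP J)).
- move=> x y; rewrite !amalg_predE => /asboolP Jx /asboolP Jy.
  apply/asboolP; rewrite /= rmorphM.
  have -> : x.2 * y.2 - f x.1 * f y.1 =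
      y.2 * (x.2 - f x.1) + f x.1 * (y.2 - f y.1).
    by rewrite !mulrBr [y.2 * _]mulrC [y.2 * f _]mulrC addrA subrK.
  by apply: JD; exact: JM.
Qed.

HB.instance Definition _ :=
  GRing.isSubringClosed.Build (A * B)%type amalg_pred amalg_subring_closed.

Definition amalg : Type := {x : A * B | x \in amalg_pred}.

HB.instance Definition _ := SubType.on amalg.
HB.instance Definition _ := [Choice of amalg by <:].
HB.instance Definition _ :=
  GRing.SubChoice_isSubComPzRing.Build (A * B)%type amalg_pred amalg
    amalg_subring_closed.

Definition amalg_max (M : set A) : set amalg :=
  val @^-1` [set (m, f m + j) | m in M & j in (J : set B)].

Hypotheses (locA : local A) (JJac : J `<=` jacobson B).

Lemma amalg_maximal_idealP (M : set A) : maximal_ideal M ->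
  forall N : set amalg, maximal_ideal N <-> N = amalg_max M.
Proof.
move=> mM; have [[M0 MD MM] M1 _] := mM; have [J0 JD JM] := idealP J.
have maxE (x : amalg) : amalg_max M x <-> M (val x).1.
  split=> [[m Mm [j _ <-]]//|Mx].
  have := valP x; rewrite amalg_predE => /asboolP Jx.
  exists (val x).1 => //; exists ((val x).2 - f (val x).1) => //.
  by rewrite addrC subrK; case: (val x).
apply: nonunits_maximal.
- split.
  + by apply/maxE.
  + by move=> x y /maxE Mx /maxE My; apply/maxE; exact: MD.
  + by move=> a x /maxE Mx; apply/maxE; exact: MM.
- by move=> /maxE.
- move=> x nMx; have {}nMx : ~ M (val x).1 by move=> Mx; apply/nMx/maxE.
  have := valP x; rewrite amalg_predE => /asboolP.
  move: nMx; case E: (val x) => [a b] /= nMa Jba.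
  have [a' aa'] : exists a', a * a' = 1.
    apply: nonunit_in_maximal => N mN.
    by rewrite -(local_maxE locA mN) (local_maxE locA mM).
  have faa' : f a * f a' = 1 by rewrite -rmorphM aa' rmorph1.
  have [b' bb'] := jacobson_unit faa' (JJac Jba).
  rewrite addrC subrK in bb'.
  have Py : (a', b') \in amalg_pred.
    rewrite amalg_predE /=; apply/asboolP.
    have -> : b' - f a' = (- (b' * f a')) * (b - f a).
      rewrite mulrBr !mulNr opprK -mulrA [f a' * b]mulrC mulrA [b' * b]mulrC bb'.
      by rewrite mul1r -mulrA [f a' * _]mulrC faa' mulr1 addrC.
    exact: JM.
  exists (Sub (a', b') Py : amalg); apply: val_inj.
  have -> : \val (x * Sub (a', b') Py) = \val x * (a', b') by [].
  by rewrite E; congr pair.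
Qed.

Lemma amalg_local : local amalg.
Proof.
have [M [mM _]] := locA; exists (amalg_max M).
by split=> [|N /(amalg_maximal_idealP mM) ->//]; apply/(amalg_maximal_idealP mM).
Qed.

End Amalgamation.

Arguments amalg_local {A B} f {J} locA JJac.

(* Main.v *)
Require Import Defs.
From HB Require Import structures.
From mathcomp Require Import all_boot all_order all_algebra.
From mathcomp Require Import boolp classical_sets.
Import GRing.Theory.
Local Open Scope classical_set_scope.
Local Open Scope ring_scope.

(** Both inequalities come from moving generating families between [A] and
    the amalgamation, whose maximal ideal consists of the pairs
    [(m, f m + j)] with [m] in [M] and [j] in [J].

    The first projection is a ring morphism from the amalgamation onto [A]
    that maps this ideal onto [M].  A surjective morphism carries generators
    of an ideal to generators of its image ([generated_by_image]), so [M]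
    needs no more generators than the maximal ideal above it.

    Conversely [(m, f m + j) = (m, f m) + (0, j)].  If the [p i] generate [M],
    the first summand is a combination of the [(p i, f (p i))] with
    coefficients [(a, f a)].  If the [q k] generate [J], then [j] is a
    combination of the [q k] with coefficients in [B]; when [B = f(A) + J]
    each coefficient [b] is the second component of some element [(a, b)] of
    the amalgamation, and [(a, b) * (0, q k) = (0, b * q k)].  Hence the
    [(p i, f (p i))] and the [(0, q k)] together generate the maximal ideal
    ([amalg_max_generated]). *)

Lemma nu_le (R : comPzRingType) (I : set R) n :
  generated_by n I -> (nu I <= n)%N.
Proof.
move=> gI; rewrite /nu; case: xgetP => [k _ [_]|_ //]; exact.
Qed.

Lemma generated_by_nu (R : comPzRingType) (I : set R) :
  fin_gen I -> generated_by (nu I) I.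
Proof.
move=> [n gI].
have exI : exists k, `[< generated_by k I >] by exists n; exact/asboolP.
case: (ex_minnP exI) => k /asboolP gk kmin.
rewrite /nu; case: xgetP => [l _ [//]|/(_ k)[]].
by split=> // l gl; apply: kmin; exact/asboolP.
Qed.

Lemma mem_span (R : comPzRingType) n (g : 'I_n -> R) i : Defs.span g (g i).
Proof.
exists (fun k => (k == i)%:R) => //.
rewrite (bigD1 i) //= eqxx mul1r big1 ?addr0 // => k /negbTE ->.
by rewrite mul0r.
Qed.

Lemma span_sub {R : comPzRingType} {n} {g : 'I_n -> R} {I : set R} :
  is_ideal I -> (forall i, I (g i)) -> Defs.span g `<=` I.
Proof.
move=> [I0 ID IM] Ig _ [c _ <-].
by apply: (big_ind I) => // i _; exact: IM.
Qed.

(** Surjectivity is needed to lift the coefficients of a combination of the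
    images; without it the image of an ideal need not be an ideal. *)
Lemma generated_by_image (R S : comPzRingType) (phi : {rmorphism R -> S})
    (I : set R) n :
  (forall s, exists r, phi r = s) -> generated_by n I ->
  generated_by n (phi @` I).
Proof.
move=> surj [g ->]; exists (phi \o g); apply/seteqP; split.
  move=> _ [_ [c _ <-] <-]; exists (phi \o c) => //.
  by rewrite rmorph_sum; apply: eq_bigr => i _; rewrite rmorphM.
move=> _ [c _ <-]; have [d dE] := choice (fun i => surj (c i)).
exists (\sum_(i < n) d i * g i); first by exists d.
by rewrite rmorph_sum; apply: eq_bigr => i _; rewrite rmorphM dE.
Qed.

Lemma generated_by_add (R : comPzRingType) (I : set R) n m
    (g : 'I_n -> R) (h : 'I_m -> R) :
  is_ideal I -> (forall i, I (g i)) -> (forall k, I (h k)) ->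
  I `<=` [set x + y | x in Defs.span g & y in Defs.span h] ->
  generated_by (n + m) I.
Proof.
move=> idI Ig Ih sI.
exists (fun i => match split i with inl j => g j | inr k => h k end).
apply/seteqP; split=> [x /sI[_ [c _ <-] [_ [d _ <-] <-]]|].
  exists (fun i => match split i with inl j => c j | inr k => d k end) => //.
  rewrite big_split_ord; congr +%R; apply: eq_bigr => i _.
    by rewrite (unsplitK (inl i)).
  by rewrite (unsplitK (inr i)).
by apply: span_sub => // i; case: split.
Qed.

Section Amalgamation.
Variables (A B : comPzRingType) (f : {rmorphism A -> B}) (J : ideal B).

Lemma mem_amalg a b : ideal_set J (b - f a) -> (a, b) \in amalg_pred f J.
Proof. by move=> Jab; rewrite amalg_predE; exact/asboolP. Qed.

Definition amalg_pair a b (Jab : ideal_set J (b - f a)) : amalg f J :=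
  Sub (a, b) (mem_amalg a b Jab).

Lemma diag_subproof a : ideal_set J (f a - f a).
Proof. by rewrite subrr; case: (idealP J). Qed.

Definition amalg_diag a : amalg f J := amalg_pair a (f a) (diag_subproof a).

Definition amalg_fst : {rmorphism amalg f J -> A} :=
  fst \o (val : amalg f J -> A * B).

Definition amalg_snd : {rmorphism amalg f J -> B} :=
  snd \o (val : amalg f J -> A * B).

Lemma amalg_ext x y :
  amalg_fst x = amalg_fst y -> amalg_snd x = amalg_snd y -> x = y.
Proof.
rewrite /= => E1 E2; apply: val_inj.
by rewrite [LHS]surjective_pairing E1 E2 -surjective_pairing.
Qed.

Lemma amalg_fst_surj a : exists x, amalg_fst x = a.
Proof. by exists (amalg_diag a). Qed.

Lemma amalg_max_diag (M : set A) m : M m -> amalg_max M (amalg_diag m).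
Proof.
by move=> Mm; exists m => //; exists 0; rewrite ?addr0 //; case: (idealP J).
Qed.

Lemma amalg_fst_max (M : set A) : amalg_fst @` @amalg_max A B f J M = M.
Proof.
apply/seteqP; split=> [_ [x [m Mm [j _ xE]] <-]|m Mm].
  by rewrite /= -xE.
by exists (amalg_diag m) => //; exact: amalg_max_diag.
Qed.

(** The ideal [J] sits in the amalgamation as the pairs [(0, j)], on which the
    first component of a coefficient has no effect: only its second component
    multiplies [j].  The elements [(p i, f (p i))] and [(0, q k)] therefore
    generate independently the two summands of [(m, f m) + (0, j)]. *)
Lemma amalg_max_generated (M : set A) n m :
  [set: B] = [set f a + j | a in [set: A] & j in (J : set B)] ->
  is_ideal M -> is_ideal (@amalg_max A B f J M) ->
  generated_by n M -> generated_by m J ->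
  generated_by (n + m) (@amalg_max A B f J M).
Proof.
move=> Bfull [M0 _ _] idN [p Mp] [q Jq].
have q0 k : ideal_set J (q k - f 0) by rewrite rmorph0 subr0 Jq; exact: mem_span.
pose g i := amalg_diag (p i).
pose h k := amalg_pair 0 (q k) (q0 k).
apply: (generated_by_add _ _ _ _ g h) => //.
- by move=> i; apply: amalg_max_diag; rewrite Mp; exact: mem_span.
- move=> k; exists 0 => //; exists (q k); last by rewrite rmorph0 add0r.
  by rewrite Jq; exact: mem_span.
move=> x [a Ma [j Jj xE]].
have [c _ cE] : Defs.span p a by rewrite -Mp.
have [d _ dE] : Defs.span q j by rewrite -Jq.
(* Coefficients in B lift to the amalgamation because B = f(A) + J. *)
have lift k : exists x : amalg f J, amalg_snd x = d k.
  have : [set: B] (d k) by [].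
  rewrite Bfull => -[a' _ [j' Jj' <-]].
  have Jd : ideal_set J (f a' + j' - f a') by rewrite addrC addKr.
  by exists (amalg_pair a' (f a' + j') Jd).
have [e eE] := choice lift.
exists (\sum_i amalg_diag (c i) * g i); first by exists (amalg_diag \o c).
exists (\sum_k e k * h k); first by exists e.
have x1 : amalg_fst x = a by rewrite /= -xE.
have x2 : amalg_snd x = f a + j by rewrite /= -xE.
apply: amalg_ext; rewrite rmorphD !rmorph_sum ?x1 ?x2.
  rewrite [X in _ + X]big1 ?addr0 => [|k _].
    by rewrite -cE; apply: eq_bigr => i _; rewrite rmorphM.
  by rewrite rmorphM; exact: mulr0.
rewrite -cE -dE rmorph_sum; congr +%R.
  by apply: eq_bigr => i _; rewrite !rmorphM.
by apply: eq_bigr => k _; rewrite rmorphM eE.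
Qed.

End Amalgamation.

Theorem proposition4p1 (A B : comPzRingType) (f : {rmorphism A -> B})
    (J : ideal B) (M : set A)
    (locA : local A) (maxM : maximal_ideal M) (JJac : J `<=` jacobson B) :
  let locAJ : local (amalg f J) := amalg_local f locA JJac in
  (fin_gen (local_max locAJ) ->
     fin_gen M /\ (embdim locA <= embdim locAJ)%N) /\
  ([set: B] = [set f a + j | a in [set: A] & j in (J : set B)] ->
   fin_gen M -> fin_gen J ->
     fin_gen (local_max locAJ) /\ (embdim locAJ <= embdim locA + nu J)%N).
Proof.
move=> locAJ.
have maxE : local_max locAJ = @amalg_max A B f J M.
  exact/(amalg_maximal_idealP locA JJac maxM)/local_maxP.
rewrite /embdim (local_maxE locA maxM) maxE; split=> [fgN|Bfull fgM fgJ].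
  have gM : generated_by (nu (@amalg_max A B f J M)) M.
    rewrite -[X in generated_by _ X](amalg_fst_max A B f J M).
    apply: generated_by_image; first exact: amalg_fst_surj.
    exact: generated_by_nu.
  by split; [exists (nu (@amalg_max A B f J M)) | exact: nu_le].
have gN : generated_by (nu M + nu J) (@amalg_max A B f J M).
  apply: amalg_max_generated => //; try exact: generated_by_nu.
    by case: maxM.
  by have [] := local_maxP locAJ; rewrite maxE.
by split; [exists (nu M + nu J)%N | exact: nu_le].
Qed.
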